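(* Let $\mathbf{k}$ be any field. (i) Let $f$ be a nonzero homogeneous cubic polynomial over $\mathbf{k}$ defining a hypersurface $X=(f=0)\subset\mathbb{P}^N$, and let $r$ be the minimal natural number such that $X$ contains a linear subspace of codimension $r$ in $\mathbb{P}^N$. Then $$\operatorname{codim}_{\mathbb{P}^N} L_f\le \frac{1}{2}\Bigl(\frac{(r+1)^2}{4}+r+3\Bigr)\cdot\Bigl(\frac{(r+1)^2}{4}+r\Bigr).$$ (ii) Let $f$ be a nonzero homogeneous polynomial over $\mathbf{k}$ of degree $d\ge 2$ defining a hypersurface $X=(f=0)\subset\mathbb{P}^N$, and assume that the minimal natural number $r$ such that $X$ contains a linear subspace of codimension $r$ in $\mathbb{P}^N$ is $r=2$ (i.e., $f$ has slice rank $2$). Then $\operatorname{codim}_{\mathbb{P}^N} L_f\le d^2+1$. More precisely, either $\operatorname{codim}_{\mathbb{P}^N} L_f\le d^2-1$, or $f$ is a pullback from a space of dimension $\le d^2+1$.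
   Context: All linear subspaces are defined over the ground field $\mathbf{k}$, and $\mathbb{P}^N=\mathbb{P}V$ with $V=\mathbf{k}^{N+1}$. Linear subspaces of $\mathbb{P}V$ correspond to vector subspaces $U\subset V$, and $\operatorname{codim}_{\mathbb{P}V}\mathbb{P}U=\dim V-\dim U$ (including $U=0$, i.e. the empty subspace, of codimension $\dim V$). ''$\mathbb{P}U$ is contained in $X=(f=0)$'' means that $f$ belongs to the ideal generated by the linear forms vanishing on $U$ (equivalently $f|_U=0$ as a polynomial). The minimal codimension $r$ is equal to the slice rank of $f$, i.e. the minimal $r$ such that $f=l_1f_1+\ldots+l_rf_r$ with $l_i$ linear forms over $\mathbf{k}$. For $f$ with this minimal codimension $r$, set $$L_f:=\bigcap_{L\subset X,\ \operatorname{codim}_{\mathbb{P}^N}L=r} L,$$ the intersection of all linear subspaces of codimension $r$ contained in $X$. A polynomial $f\in\mathbf{k}[V]=S(V^* )$ is a pullback from a space of dimension $m$ if there is a linear subspace $W\subset V^*$ of dimension $m$ such that $f\in S(W)\subset S(V^* )$. *)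

(* Defs.v *)
From mathcomp Require Import all_boot all_order all_algebra.
From mathcomp Require Export mpoly.
From Stdlib Require Import Classical ClassicalEpsilon.

Set Implicit Arguments.
Unset Strict Implicit.
Unset Printing Implicit Defensive.

Import GRing.Theory.
Local Open Scope ring_scope.

Section Intersection.
Variables (K : fieldType) (vT : vectType K) (P : {vspace vT} -> Prop).

Lemma vsinter_exists :
  exists W : {vspace vT}, forall v, v \in W <-> (forall U, P U -> v \in U).
Proof.
suff H m : forall W : {vspace vT}, (\dim W <= m)%N ->
    (forall v, (forall U, P U -> v \in U) -> v \in W) ->
    exists W : {vspace vT}, forall v, v \in W <-> (forall U, P U -> v \in U).
  by apply: (H (\dim {:vT}) fullv) => // v _; exact: memvf.
elim: m => [|m IH] W leW subW.
  exists W => v; split; last exact: subW.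
  move: leW; rewrite leqn0 dimv_eq0 => /eqP -> /[!memv0] /eqP -> U _.
  exact: mem0v.
have [WU|] := classic (forall U, P U -> (W <= U)%VS).
  exists W => v; split; last exact: subW.
  by move=> vW U PU; exact: (subvP (WU U PU)).
move=> nWU; have [U nU] := not_all_ex_not _ _ nWU.
have [PU /negP nWU'] := imply_to_and _ _ nU.
apply: (IH (W :&: U)%VS) => [|v vU]; last by rewrite memv_cap subW ?vU.
rewrite -ltnS; apply: leq_trans leW.
have := dimv_leqif_sup (capvSl W U) => /ltn_leqif ->.
by rewrite subv_cap subvv.
Qed.

Definition vsinter : {vspace vT} :=
  proj1_sig (constructive_indefinite_description _ vsinter_exists).

Lemma vsinterP v : v \in vsinter <-> (forall U, P U -> v \in U).
Proof.
exact: (proj2_sig (constructive_indefinite_description _ vsinter_exists)).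
Qed.

End Intersection.

Section LinearSubspaces.
Variables (K : fieldType) (N : nat).
Local Notation n := N.+1.

(* V is 'rV[K]_N.+1, so that P^N = PV; the symmetric algebra of the dual of V
   is {mpoly K[N.+1]} and the dual itself its degree-one part
   dhomog N.+1 K 1. *)

Definition codim (U : {vspace 'rV[K]_n}) : nat :=
  (\dim {:'rV[K]_n} - \dim U)%N.

Definition vanishes_on (l : dhomog n K 1) (U : {vspace 'rV[K]_n}) : Prop :=
  forall u, u \in U -> (mpoly_of_dhomog l).@[fun i => u 0 i] = 0.

Definition in_ideal (S : {mpoly K[n]} -> Prop) (f : {mpoly K[n]}) : Prop :=
  exists s : seq ({mpoly K[n]} * {mpoly K[n]}),
    (forall p, p \in s -> S p.1) /\ f = \sum_(p <- s) p.1 * p.2.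

(* Containment is scheme-theoretic: over a finite field it is stronger than
   the vanishing of f at all the K-points of U. *)
Definition contained_in_hypersurface
    (U : {vspace 'rV[K]_n}) (f : {mpoly K[n]}) : Prop :=
  in_ideal (fun g => exists2 l : dhomog n K 1,
              vanishes_on l U & g = mpoly_of_dhomog l) f.

Definition is_min_codim (f : {mpoly K[n]}) (r : nat) : Prop :=
  (exists2 U, contained_in_hypersurface U f & codim U = r) /\
  (forall U, contained_in_hypersurface U f -> (r <= codim U)%N).

(* This is L_f when is_min_codim f r holds. *)
Definition Lf (f : {mpoly K[n]}) (r : nat) : {vspace 'rV[K]_n} :=
  vsinter (fun U => contained_in_hypersurface U f /\ codim U = r).

(* S(W), as the subalgebra of {mpoly K[N.+1]} generated by W. *)
Definition in_sym (W : {vspace dhomog n K 1}) (f : {mpoly K[n]}) : Prop :=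
  exists (k : nat) (w : k.-tuple (dhomog n K 1)) (q : {mpoly K[k]}),
    (forall i, tnth w i \in W) /\
    f = q \mPo (map_tuple (@mpoly_of_dhomog n K 1) w).

Definition is_pullback (f : {mpoly K[n]}) (m : nat) : Prop :=
  exists2 W : {vspace dhomog n K 1}, \dim W = m & in_sym W f.

End LinearSubspaces.

(* Main.v *)
(* Write F for the family of r-dimensional spaces W of linear forms with f in the
   ideal (W); then codim L_f is the dimension of the span of F.

   (i) Let I be the intersection of F.  Finitely many members, of sum A, already
   intersect in I, and dim A <= r + c + c (r - c - dim I) for some c, which is at
   most r + (r + 1)^2 / 4 when I = 0.  Since f is cubic and lies in each of their
   ideals, f lies in (I) + (A)^2: modulo (I) it is a sum of at most j (j + 1) / 2
   products a b n, where a, b run over a basis of a complement of I in A, of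
   dimension j, and n is a linear form.  Every member of F is contained in the
   span Z of A and of the forms n: a projection killing a form of W outside Z and
   fixing Z would produce a smaller space whose ideal still contains f.

   (ii) Let W_1, ..., W_s be members of F with direct sum A, with s maximal.
   Every W in F meets A; so F spans A together with v_1, ..., v_m, independent
   modulo A, such that f is in (w_j, v_j) for some nonzero w_j in A.  Expand f in
   monomials in the v_j.  The coefficients lie in the product of the (W_i), so
   they have degree at least s; if v_j does not divide the monomial, w_j divides
   its coefficient.  A coefficient not divisible by w shows that at most d - s of
   the w_j are proportional to w, and any nonzero one that there are at most d
   proportionality classes.  So codim L_f <= 2 s + d (d - s), which is at most
   d^2 - 1 as soon as d >= 3; for d = 2 the quadric f = l_1 m_1 + l_2 m_2 is a
   pullback from the span of the four forms. *)
From HB Require Import structures.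
Require Import Defs.
From mathcomp Require Import all_boot all_order all_algebra.
From mathcomp Require Import mpoly.
From mathcomp Require Import zify ring.
From Stdlib Require Import Classical.

Set Implicit Arguments.
Unset Strict Implicit.
Unset Printing Implicit Defensive.

Import GRing.Theory Num.Theory Order.TTheory.
Local Open Scope ring_scope.

(** * Ideals generated by linear forms *)

Section LinearForms.
Variable K : fieldType.

Definition lin n (a : 'rV[K]_n) : {mpoly K[n]} := \sum_i a 0 i *: 'X_i.

Fact lin_is_linear n : linear (@lin n).
Proof.
move=> c a b; rewrite /lin scaler_sumr -big_split; apply: eq_bigr => i _ /=.
by rewrite !mxE scalerDl scalerA.
Qed.
HB.instance Definition _ n := GRing.isLinear.Build K 'rV[K]_n {mpoly K[n]} *:%R
  (@lin n) (@lin_is_linear n).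

Lemma lin_coef n (a : 'rV[K]_n) i : (lin a)@_U_(i) = a 0 i.
Proof.
rewrite /lin raddf_sum (bigD1 i) //= mcoeffZ mcoeffXU eqxx mulr1 big1 ?addr0 //.
by move=> j /negPf ji; rewrite mcoeffZ mcoeffXU ji mulr0.
Qed.

Lemma lin_eq0 n (a : 'rV[K]_n) : (lin a == 0) = (a == 0).
Proof.
apply/eqP/eqP => [a0|->]; last exact: linear0.
by apply/rowP => i; rewrite -lin_coef a0 mcoeff0 mxE.
Qed.

Lemma lin_delta n i : lin (delta_mx 0 i) = 'X_i :> {mpoly K[n]}.
Proof.
rewrite /lin (bigD1 i) //= mxE !eqxx scale1r big1 ?addr0 //.
by move=> j /negPf ji; rewrite mxE ji scale0r.
Qed.

Lemma lin_homog n (a : 'rV[K]_n) : lin a \is 1.-homog.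
Proof. by apply: rpred_sum => i _; apply: rpredZ; rewrite dhomogX; apply/eqP/mdeg1. Qed.

Lemma homog1_lin n (p : {mpoly K[n]}) :
  p \is 1.-homog -> p = lin (\row_i p@_U_(i)).
Proof.
move=> hp; apply/mpolyP => m.
have [/mdeg1P[i /eqP->]|m1] := boolP (mdeg m == 1)%N; first by rewrite lin_coef mxE.
by rewrite !(dhomog_nemf_coeff _ m1) // lin_homog.
Qed.

(** Linear forms are coefficient rows, so substitutions compose as matrix products; coordinate
    changes, projections and reduction modulo linear forms all become instances of [substmx]. *)
Definition substmx m n (M : 'M[K]_(m, n)) (p : {mpoly K[m]}) : {mpoly K[n]} :=
  p \mPo [tuple lin (row i M) | i < m].

HB.instance Definition _ m n (M : 'M[K]_(m, n)) :=
  GRing.RMorphism.copy (substmx M) (comp_mpoly [tuple lin (row i M) | i < m]).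
HB.instance Definition _ m n (M : 'M[K]_(m, n)) :=
  GRing.Linear.copy (substmx M) (comp_mpoly [tuple lin (row i M) | i < m]).

Lemma subX m n (M : 'M[K]_(m, n)) i : substmx M 'X_i = lin (row i M).
Proof. by rewrite /substmx comp_mpolyXU -tnth_nth tnth_mktuple. Qed.

Lemma sub_lin m n (M : 'M[K]_(m, n)) a : substmx M (lin a) = lin (a *m M).
Proof.
rewrite {1}/lin linear_sum mulmx_sum_row linear_sum.
by apply: eq_bigr => i _ /=; rewrite !linearZ /= subX.
Qed.

Lemma mpoly_ind_alg n (P : {mpoly K[n]} -> Prop) :
  (forall c p, P p -> P (c *: p)) -> (forall p q, P p -> P q -> P (p + q)) ->
  P 1 -> (forall i p, P p -> P ('X_i * p)) -> forall p, P p.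
Proof.
move=> PZ PD P1 PX p; rewrite (mpolyE p).
apply: big_ind => [|x y|m _]; first by rewrite -(scale0r (1 : {mpoly K[n]})); apply: PZ.
  exact: PD.
apply: PZ; rewrite mpolyXE_id -[X in P X]mulr1.
suff H q : P q -> P ((\prod_(i < n) 'X_i ^+ m i) * q) by exact: H.
elim/big_rec: _ q => [|i y _ IH] q Pq; first by rewrite mul1r.
rewrite -mulrA; elim: (m i) => [|k IHk]; first by rewrite mul1r; apply: IH.
by rewrite exprS -mulrA; apply: PX.
Qed.

Lemma sub_comp m n p (M : 'M[K]_(m, n)) (N : 'M_(n, p)) f :
  substmx N (substmx M f) = substmx (M *m N) f.
Proof.
elim/mpoly_ind_alg: f => [c f IH|f g IHf IHg||i f IH].
- by rewrite !linearZ /= IH.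
- by rewrite !linearD /= IHf IHg.
- by rewrite !rmorph1.
by rewrite !rmorphM /= IH !subX sub_lin row_mul.
Qed.

Lemma sub_id n (f : {mpoly K[n]}) : substmx 1%:M f = f.
Proof.
elim/mpoly_ind_alg: f => [c f IH|f g IHf IHg||i f IH].
- by rewrite linearZ /= IH.
- by rewrite linearD /= IHf IHg.
- by rewrite rmorph1.
by rewrite rmorphM /= IH subX row1 lin_delta.
Qed.

Lemma sub_homog m n (M : 'M[K]_(m, n)) d f :
  f \is d.-homog -> substmx M f \is d.-homog.
Proof.
move/dhomogP => hf; rewrite (mpolyE f) linear_sum big_seq.
apply: rpred_sum => mu /hf <-; rewrite linearZ rpredZ //=.
rewrite mpolyXE_id rmorph_prod mdegE.
elim/big_rec2: _ => [|i e p _ IH]; first exact: dhomog1.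
apply: dhomogM IH; rewrite rmorphXn /= subX -[mu i in X in X.-homog]mul1n.
exact/dhomogMn/lin_homog.
Qed.

(** The number of rows is free: one row expresses divisibility by a linear form, [col_mx a b] a
    pair, a square matrix a space of forms. Only the row space matters, by [in_idS]. *)
Definition in_id k n (B : 'M[K]_(k, n)) (f : {mpoly K[n]}) : Prop :=
  exists g : 'I_k -> {mpoly K[n]}, f = \sum_i lin (row i B) * g i.

Section Ideal.
Variables (k n : nat) (B : 'M[K]_(k, n)).
Implicit Types f g : {mpoly K[n]}.

Lemma in_id0 : in_id B 0.
Proof. by exists (fun=> 0); rewrite big1 // => i _; rewrite mulr0. Qed.

Lemma in_idD f g : in_id B f -> in_id B g -> in_id B (f + g).
Proof.
move=> [u ->] [v ->]; exists (fun i => u i + v i).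
by rewrite -big_split; apply: eq_bigr => i _; rewrite mulrDr.
Qed.

Lemma in_idMl f g : in_id B f -> in_id B (g * f).
Proof.
move=> [u ->]; exists (fun i => g * u i).
by rewrite mulr_sumr; apply: eq_bigr => i _; rewrite mulrCA.
Qed.

Lemma in_idMr f g : in_id B f -> in_id B (f * g).
Proof. by rewrite mulrC; apply: in_idMl. Qed.

Lemma in_idZ c f : in_id B f -> in_id B (c *: f).
Proof. by rewrite -mul_mpolyC; apply: in_idMl. Qed.

Lemma in_idB f g : in_id B f -> in_id B g -> in_id B (f - g).
Proof. by move=> hf hg; rewrite -scaleN1r; apply/in_idD/in_idZ. Qed.

Lemma in_id_sum (I : Type) (s : seq I) (P : pred I) F :
  (forall i, P i -> in_id B (F i)) -> in_id B (\sum_(i <- s | P i) F i).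
Proof. by move=> HF; elim/big_rec: _ => [|i f Pi]; [exact: in_id0|apply/in_idD/HF]. Qed.

Lemma in_id_lin (a : 'rV_n) : (a <= B)%MS -> in_id B (lin a).
Proof.
case/submxP => c ->; exists (fun i => (c 0 i)%:MP).
rewrite mulmx_sum_row linear_sum; apply: eq_bigr => i _.
by rewrite /= linearZ mulrC mul_mpolyC.
Qed.

Lemma sub_in_id0 l (C : 'M_(n, l)) f : B *m C = 0 -> in_id B f -> substmx C f = 0.
Proof.
move=> BC [u ->]; rewrite linear_sum big1 // => i _.
by rewrite rmorphM /= sub_lin -row_mul BC row0 linear0 mul0r.
Qed.

(** The two substitutions agree on variables modulo the ideal, hence on products: x f - y g = x (f -
    g) + (x - y) g. *)
Lemma sub_congr l (M N : 'M_(l, n)) (f : {mpoly K[l]}) :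
  (M - N <= B)%MS -> in_id B (substmx M f - substmx N f).
Proof.
move=> MN; elim/mpoly_ind_alg: f => [c f IH|f g IHf IHg||i f IH].
- by rewrite 2!linearZ /= -scalerBr; apply: in_idZ.
- by rewrite 2!linearD /= opprD addrACA; apply: in_idD.
- by rewrite !rmorph1 subrr; apply: in_id0.
rewrite !rmorphM /= -[X in in_id B (X - _)](subrK (substmx M 'X_i * substmx N f)).
rewrite -mulrBr -addrA -mulrBl; apply: in_idD; first exact: in_idMl.
apply: in_idMr; rewrite !subX -linearB -linearB; apply: in_id_lin.
exact: submx_trans (row_sub _ _) MN.
Qed.

End Ideal.

Lemma in_idS k l n (B : 'M[K]_(k, n)) (C : 'M_(l, n)) f :
  (B <= C)%MS -> in_id B f -> in_id C f.
Proof.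
move=> BC [g ->]; apply: in_id_sum => i _; apply/in_idMr/in_id_lin.
exact: submx_trans (row_sub _ _) BC.
Qed.

Lemma in_id_sub k m n (B : 'M[K]_(k, m)) (M : 'M_(m, n)) f :
  in_id B f -> in_id (B *m M) (substmx M f).
Proof.
case=> g ->; exists (fun i => substmx M (g i)); rewrite linear_sum.
by apply: eq_bigr => i _; rewrite rmorphM /= sub_lin row_mul.
Qed.

(* The rows of [1 - C *m pinvmx C], for [C] the cokernel of [B], lie in the row
   space of [B]; hence [f] is congruent to its image under a substitution that
   factors through [C]. *)
Lemma in_idP k n (B : 'M[K]_(k, n)) f : in_id B f <-> substmx (cokermx B) f = 0.
Proof.
split=> [|f0]; first by apply: sub_in_id0; rewrite mulmx_coker.
set C := cokermx B in f0; pose P := C *m pinvmx C.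
have PB : (1%:M - P <= B)%MS.
  by rewrite submxE mulmxBl mul1mx mulmxKpV // subrr.
have := sub_congr f PB; rewrite sub_id -sub_comp f0 linear0 subr0 //.
Qed.

(** By [in_idP] the ideal is the kernel of a ring morphism into a domain, so it is prime. *)
Lemma in_idM k n (B : 'M[K]_(k, n)) f g :
  in_id B (f * g) -> in_id B f \/ in_id B g.
Proof.
rewrite !in_idP rmorphM /= => /eqP; rewrite mulf_eq0.
by case/orP => /eqP; [left|right].
Qed.

Lemma lin_in_id k n (B : 'M[K]_(k, n)) (a : 'rV_n) :
  in_id B (lin a) <-> (a <= B)%MS.
Proof.
by rewrite in_idP sub_lin submxE; split=> [/eqP|/eqP->]; rewrite ?lin_eq0 ?linear0.
Qed.

End LinearForms.

(** * Linear subspaces and the forms vanishing on them *)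

Section Annihilator.
Variables (K : fieldType) (N : nat).
Local Notation n := N.+1.
Implicit Types (U : {vspace 'rV[K]_n}) (f : {mpoly K[n]}).

Definition vsmx U : 'M[K]_(\dim U, n) := \matrix_(i < \dim U) (vbasis U)`_i.

Lemma vsmxP U (u : 'rV_n) : (u <= vsmx U)%MS = (u \in U).
Proof.
apply/idP/idP => [/submxP[c ->]|/coord_vbasis->].
  rewrite mulmx_sum_row; apply: memv_suml => i _; rewrite memvZ // rowK.
  by apply: vbasis_mem; rewrite mem_nth // size_tuple.
apply: summx_sub => i _; apply: scalemx_sub.
by rewrite -(rowK (fun i => (vbasis U)`_i) i) row_sub.
Qed.

Lemma rank_vsmx U : \rank (vsmx U) = \dim U.
Proof.
apply/eqP/inj_row_free => v; rewrite mulmx_sum_row => v0.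
have /freeP/(_ (fun i => v 0 i)) v_eq0 := basis_free (vbasisP U).
apply/rowP => i; rewrite mxE; apply: v_eq0; rewrite -[RHS]v0.
by apply: eq_bigr => j _; rewrite rowK.
Qed.

Lemma codimE U : codim U = (n - \dim U)%N.
Proof. by rewrite /codim dimvf /dim /= mul1n. Qed.

Definition annmx U : 'M[K]_n := kermx (vsmx U)^T.

Lemma annmxP U (a : 'rV_n) :
  (a <= annmx U)%MS <-> (forall u, u \in U -> a *m u^T = 0).
Proof.
split=> [/sub_kermxP aU u|aU].
  rewrite -vsmxP => /submxP[c ->].
  by rewrite trmx_mul mulmxA aU mul0mx.
apply/sub_kermxP/trmx_inj; rewrite trmx_mul trmxK trmx0.
apply/row_matrixP => i; rewrite row_mul row0; apply: trmx_inj.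
by rewrite trmx_mul trmxK trmx0; apply: aU; rewrite -vsmxP row_sub.
Qed.

Lemma rank_annmx U : \rank (annmx U) = codim U.
Proof. by rewrite mxrank_ker mxrank_tr rank_vsmx codimE. Qed.

Lemma lin_eval (a u : 'rV[K]_n) : (lin a).@[fun i => u 0 i] = (a *m u^T) 0 0.
Proof.
rewrite mxE rmorph_sum /=; apply: eq_bigr => i _.
by rewrite mevalZ mevalXU mxE.
Qed.

Lemma vanishes_onE (l : dhomog n K 1) (a : 'rV_n) U :
  mpoly_of_dhomog l = lin a -> (vanishes_on l U <-> (a <= annmx U)%MS).
Proof.
move=> la; rewrite annmxP /vanishes_on la; split=> aU u /aU; rewrite lin_eval.
  by move=> au; apply/matrixP => i j; rewrite !ord1 au mxE.
by move->; rewrite mxE.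
Qed.

Lemma contained_in_id U f :
  contained_in_hypersurface U f <-> in_id (annmx U) f.
Proof.
split=> [[s [sU ->]]|[g ->]].
  rewrite big_seq; apply: in_id_sum => p /sU[l lU ->]; apply: in_idMr.
  have la := homog1_lin (dhomog_is_dhomog l).
  by rewrite [mpoly_of_dhomog l]la; apply/in_id_lin/(vanishes_onE _ la).
exists [seq (lin (row i (annmx U)), g i) | i <- enum 'I_n]; split.
  move=> _ /mapP[i _ ->] /=; exists (DHomog (lin_homog (row i (annmx U)))) => //.
  by apply/(vanishes_onE (a := row i (annmx U))) => //; apply: row_sub.
by rewrite big_map big_enum.
Qed.

Section ZeroSpace.
Variables (k : nat) (B : 'M[K]_(k, n)).

Definition zerosp : {vspace 'rV[K]_n} := lker (linfun (mulmxr B^T)).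

Lemma zerospP u : (u \in zerosp) = (u *m B^T == 0).
Proof. by rewrite memv_ker lfunE. Qed.

Lemma codim_zerosp : codim zerosp = \rank B.
Proof.
have -> : codim zerosp = (n - \rank (kermx B^T))%N.
  rewrite codimE -rank_vsmx; congr (_ - _)%N; apply/eqmx_rank/rV_eqP => u.
  by rewrite vsmxP zerospP; apply/eqP/sub_kermxP.
by rewrite mxrank_ker mxrank_tr subKn // rank_leq_col.
Qed.

Lemma sub_ann_zerosp : (B <= annmx zerosp)%MS.
Proof.
apply/row_subP => i; apply/annmxP => u; rewrite zerospP => /eqP uB.
by rewrite -row_mul -[B]trmxK -trmx_mul uB trmx0 row0.
Qed.

(** The columns of the cokernel of [vsmx U] are forms that cut out [U]; they vanish on [U], so they
    lie in the row space of [B]. *)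
Lemma zerosp_sub U : (annmx U <= B)%MS -> (zerosp <= U)%VS.
Proof.
move=> UB; apply/subvP => u; rewrite zerospP => /eqP uB.
rewrite -vsmxP submxE; set C := cokermx _.
have /submxP[D CD] : (C^T <= B)%MS.
  by apply: submx_trans UB; apply/sub_kermxP; rewrite -trmx_mul mulmx_coker trmx0.
by rewrite -[C]trmxK CD trmx_mul mulmxA uB mul0mx.
Qed.

End ZeroSpace.

Definition min_family f r (B : 'M[K]_n) : Prop := in_id B f /\ \rank B = r.

(** The annihilator of each subspace in the intersection is a member of the family, so the common
    zeros of [Z] lie in [Lf f r]. It remains to find a small [Z] containing the family. *)
Lemma codim_Lf f r (Z : 'M[K]_n) :
  (forall B, min_family f r B -> (B <= Z)%MS) -> (codim (Lf f r) <= \rank Z)%N.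
Proof.
move=> FZ; rewrite -codim_zerosp !codimE; apply/leq_sub2l/dimvS.
apply/subvP => u uZ; apply/vsinterP => U [/contained_in_id Uf codU].
by apply: subvP u uZ; apply/zerosp_sub/FZ; split; rewrite ?rank_annmx.
Qed.

Lemma min_codimP f r : is_min_codim f r ->
  (exists B, min_family f r B) /\
  (forall k (B : 'M[K]_(k, n)), in_id B f -> (r <= \rank B)%N).
Proof.
move=> [[U /contained_in_id Uf codU] rmin]; split.
  by exists (annmx U); split; rewrite ?rank_annmx.
move=> k B Bf; rewrite -codim_zerosp; apply/rmin/contained_in_id.
exact: in_idS (sub_ann_zerosp B) Bf.
Qed.

End Annihilator.

(** * Slice rank two *)

Section Restriction.
Variables (K : fieldType) (k : nat).
Implicit Types (p : {mpoly K[k]}) (Q : pred 'X_{1..k}) (i : 'I_k).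

Lemma mcoeffXM i p mu :
  ('X_i * p)@_mu = if (0 < mu i)%N then p@_(mu - U_(i))%MM else 0.
Proof.
rewrite mulrC; case: ifP => [mui|/negbT mui].
  by rewrite -[in LHS](@submK _ U_(i)%MM mu) ?lep1mP -?lt0n // addmC mcoeffMX.
apply/eqP; rewrite mcoeff_eq0; apply: contra mui.
rewrite (perm_mem (msuppMX _ _)) => /mapP[nu _ ->].
by rewrite mnmDE mnm1E eqxx.
Qed.

Definition restr Q p : {mpoly K[k]} :=
  \sum_(mu <- msupp p | Q mu) p@_mu *: 'X_[mu].

Lemma mcoeff_restr Q p mu : (restr Q p)@_mu = if Q mu then p@_mu else 0.
Proof.
rewrite /restr raddf_sum big_mkcond /=.
have E nu : (if Q nu then (p@_nu *: 'X_[nu])@_mu else 0) =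
    if nu == mu then (if Q mu then p@_mu else 0) else 0.
  by rewrite mcoeffZ mcoeffX; case: eqP => [->|_]; rewrite ?mulr1 ?mulr0; case: ifP.
rewrite (eq_bigr _ (fun nu _ => E nu)); have [mup|mup] := boolP (mu \in msupp p).
  by rewrite (bigD1_seq mu) //= eqxx big1 ?addr0 // => nu /negPf->.
rewrite big_seq big1 => [|nu nup]; first by rewrite (memN_msupp_eq0 mup) if_same.
by case: eqP => // numu; rewrite numu (negPf mup) in nup.
Qed.

Fact restr_is_linear Q : linear (restr Q).
Proof.
move=> c p q; apply/mpolyP => mu.
rewrite mcoeffD mcoeffZ !mcoeff_restr mcoeffD mcoeffZ.
by case: ifP => _; rewrite ?mulr0 ?addr0.
Qed.
HB.instance Definition _ Q := GRing.isLinear.Build K {mpoly K[k]} {mpoly K[k]} *:%R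
  (restr Q) (@restr_is_linear Q).

Lemma msupp_restr Q p mu : mu \in msupp (restr Q p) = Q mu && (mu \in msupp p).
Proof. by rewrite !mcoeff_msupp mcoeff_restr; case: (Q mu); rewrite //= eqxx. Qed.

Lemma restrXM Q i p : (forall mu, Q (mu + U_(i))%MM = Q mu) ->
  restr Q ('X_i * p) = 'X_i * restr Q p.
Proof.
move=> QU; apply/mpolyP => mu; rewrite mcoeff_restr !mcoeffXM mcoeff_restr.
case: (ltnP 0 (mu i)) => [mui|]; last by rewrite if_same.
by rewrite -(QU (mu - _)%MM) submK // lep1mP -lt0n.
Qed.

Lemma restr_linM Q (a : 'rV_k) p :
  (forall i, a 0 i != 0 -> forall mu, Q (mu + U_(i))%MM = Q mu) ->
  restr Q (lin a * p) = lin a * restr Q p.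
Proof.
move=> aQ; rewrite {1}/lin mulr_suml linear_sum mulr_suml; apply: eq_bigr => i _ /=.
have [->|ai] := eqVneq (a 0 i) 0; first by rewrite !scale0r !mul0r linear0.
by rewrite -!scalerAl linearZ /= restrXM //; apply: aQ.
Qed.

Lemma restr_partition (T : eqType) (F : 'X_{1..k} -> T) p :
  p = \sum_(t <- undup (map F (msupp p))) restr (fun mu => F mu == t) p.
Proof.
apply/mpolyP => mu; rewrite raddf_sum /=.
rewrite (eq_bigr _ (fun t _ => mcoeff_restr _ p mu)).
have [mup|mup] := boolP (mu \in msupp p); last first.
  by rewrite memN_msupp_eq0 // big1 // => t _; rewrite if_same.
rewrite (bigD1_seq (F mu)) ?undup_uniq ?mem_undup ?map_f //= eqxx.
by rewrite big1 ?addr0 // => t; rewrite eq_sym => /negPf->.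
Qed.

End Restriction.

(** Pairwise non-proportional linear forms are non-associated primes. The next form divides the
    product already split off times the cofactor, but no factor of that product, so it divides the
    cofactor. *)
Lemma prod_lin_dvd (K : fieldType) k (I : eqType) (l : seq I)
    (a : I -> 'rV[K]_k) h :
  uniq l -> {in l, forall i, a i != 0} ->
  {in l &, forall i j, (a i <= a j)%MS -> i = j} ->
  {in l, forall i, in_id (a i) h} ->
  exists q, h = (\prod_(i <- l) lin (a i)) * q.
Proof.
elim: l => [|i l IH] /=; first by exists h; rewrite big_nil mul1r.
move=> /andP[il ul] nz sep dvd.
have sub_l j : j \in l -> j \in i :: l by rewrite inE orbC => ->.
have [||||q hq] := IH => //.
- by move=> j /sub_l/nz.
- by move=> j j' /sub_l jl /sub_l; apply: sep.
- by move=> j /sub_l/dvd.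
have : in_id (a i) (\prod_(j <- l) lin (a j) * q).
  by rewrite -hq; apply: dvd; rewrite mem_head.
case/in_idM => [|[g qg]]; last first.
  exists (g 0); rewrite hq qg big_ord1 row_id big_cons !mulrA; congr (_ * _).
  exact: mulrC.
rewrite big_seq; elim/big_rec: _ => [/in_idP|j p jl IHp /in_idM[/lin_in_id|//]].
  by rewrite rmorph1 => /eqP; rewrite oner_eq0.
by move=> /(sep _ _ (sub_l _ jl) (mem_head _ _)) ji; rewrite -ji jl in il.
Qed.

(** * Counting pairs in coordinates *)

Section PairCount.
Variables (K : fieldType) (s m q : nat).
Let k := (s + s + m + q)%N.
(* The variables are [x_i], [y_i] (a basis of [W_i]), [v_j] and [q] others. *)
Let x (i : 'I_s) : 'I_k := lshift q (lshift m (lshift s i)).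
Let y (i : 'I_s) : 'I_k := lshift q (lshift m (rshift s i)).
Let v (j : 'I_m) : 'I_k := lshift q (rshift (s + s) j).

Variables (g : {mpoly K[k]}) (d : nat) (w : 'I_m -> 'rV[K]_k).
Hypotheses (g_neq0 : g != 0) (gd : g \is d.-homog).
Hypothesis gxy : forall i, exists a b, g = 'X_(x i) * a + 'X_(y i) * b.
Hypothesis gwv : forall j, exists a b, g = lin (w j) * a + 'X_(v j) * b.
Hypothesis wv0 : forall j l, w j 0 (v l) = 0.
Hypothesis w_neq0 : forall j, w j != 0.
Hypothesis gw : forall j, ~ in_id (w j) g.

(** Lying in the ideal of x_i and y_i, g has one of these two variables in each of its monomials;
    this uses up s degrees disjoint from those in the v_j. *)
Lemma pair_mdeg mu : mu \in msupp g -> (s + \sum_j mu (v j) <= d)%N.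
Proof.
move=> mug; have <- : mdeg mu = d := dhomog_mf gd mug.
rewrite mdegE !big_split_ord /=.
apply: leq_trans (leq_addr _ _); rewrite leq_add2r -big_split /=.
rewrite -[X in (X <= _)%N]card_ord -sum1_card; apply: leq_sum => i _.
have [a [b gab]] := gxy i; move: mug; rewrite mcoeff_msupp gab mcoeffD !mcoeffXM.
apply: contraNT; rewrite -leqNgt leqn0 addn_eq0 => /andP[/eqP-> /eqP->].
by rewrite addr0.
Qed.

Let vpart (mu : 'X_{1..k}) : {ffun 'I_m -> nat} := [ffun j => mu (v j)].
(** This is the coefficient of v^al in p, still multiplied by v^al. *)
Let part (al : {ffun 'I_m -> nat}) (p : {mpoly K[k]}) :=
  restr (fun mu => vpart mu == al) p.

Lemma part_linM al j p : part al (lin (w j) * p) = lin (w j) * part al p.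
Proof.
apply: restr_linM => i wi mu; congr (_ == _); apply/ffunP => l.
rewrite !ffunE mnmDE mnm1E; case: eqP => [il|]; last by rewrite addn0.
by rewrite il wv0 eqxx in wi.
Qed.

(** Modulo v_j, g is a multiple of [w j]. As [w j] involves no v variable, divisibility passes to
    each part free of v_j. *)
Lemma in_id_part (al : {ffun 'I_m -> nat}) j : al j = 0%N -> in_id (w j) (part al g).
Proof.
move=> alj; have [a [b gab]] := gwv j; exists (fun=> part al a).
rewrite big_ord1 row_id -part_linM gab /part linearD /=.
suff -> : restr (fun mu => vpart mu == al) ('X_(v j) * b) = 0 by rewrite addr0.
apply/mpolyP => mu; rewrite mcoeff_restr mcoeff0 mcoeffXM.
by case: eqP => // /ffunP/(_ j); rewrite ffunE alj => ->.
Qed.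

Lemma part_supp al p mu : mu \in msupp (part al p) ->
  (mu \in msupp p) /\ forall j, mu (v j) = al j.
Proof. by rewrite msupp_restr => /andP[/eqP<- ->]; split=> // j; rewrite ffunE. Qed.

(** Since [w j0] does not divide g, it fails to divide some part. There v_j must occur for each
    [w j] proportional to [w j0], and [pair_mdeg] leaves only d - s degrees for the v variables. *)
Lemma pair_class_size j0 : (#|[set j | (w j <= w j0)%MS]| <= d - s)%N.
Proof.
have [al nal] : exists al, ~ in_id (w j0) (part al g).
  apply: NNPP => nex; apply: (@gw j0); rewrite (restr_partition vpart g).
  by apply: in_id_sum => al _; apply: NNPP => nal; apply: nex; exists al.
have /mlead_supp/part_supp[mug mual] : part al g != 0.
  by apply/eqP => g0; apply: nal; rewrite g0; apply: in_id0.
apply: leq_trans (leq_sub2r s (pair_mdeg mug)); rewrite addKn.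
rewrite -sum1_card big_mkcond /=; apply: leq_sum => j _.
rewrite inE; case: ifP => // wj; rewrite lt0n mual.
by apply/eqP => /in_id_part/(in_idS wj)/nal.
Qed.

(** In the part of the leading monomial, the [w j] with [al j = 0] are coprime divisors, and the
    cofactor still carries v^al. Each index of [T] thus costs one of the d degrees. *)
Lemma pair_classes (T : {set 'I_m}) :
  {in T &, forall i j, (w i <= w j)%MS -> i = j} -> (#|T| <= d)%N.
Proof.
move=> sepT; pose al := vpart (mlead g); pose h := part al g.
have h0 : h != 0.
  apply: contra g_neq0 => /eqP/mpolyP/(_ (mlead g)).
  by rewrite mcoeff_restr eqxx mcoeff0 => /eqP; rewrite mleadc_eq0.
pose T2 := [set j in T | al j == 0%N].
have [||||q' hq] := @prod_lin_dvd K k _ (enum T2) w h.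
- exact: enum_uniq.
- by move=> j _; apply: w_neq0.
- by move=> i j; rewrite !mem_enum !inE => /andP[iT _] /andP[jT _]; apply: sepT.
- by move=> j; rewrite mem_enum inE => /andP[_ /eqP]; apply: in_id_part.
(* The [w i] involve no v variable, so the cofactor may be replaced by its own [al] part, whose
   monomials have v-exponents exactly [al]. *)
have {}hq : h = (\prod_(i <- enum T2) lin (w i)) * part al q'.
  transitivity (part al h).
    by apply/mpolyP => mu; rewrite !mcoeff_restr; case: ifP.
  rewrite hq; elim: (enum T2) => [|i l IH]; first by rewrite !big_nil !mul1r.
  by rewrite !big_cons -!mulrA part_linM IH.
have q0 : part al q' != 0 by apply: contraNneq h0 => q0; rewrite hq q0 mulr0.
have P0 : \prod_(i <- enum T2) lin (w i) != 0.
  by apply: contraNneq h0 => P0; rewrite hq P0 mul0r.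
have /part_supp[hg _] := mlead_supp h0.
have dh : mdeg (mlead h) = d := dhomog_mf gd hg.
have Pd : mdeg (mlead (\prod_(i <- enum T2) lin (w i))) = #|T2|.
  have /dhomog_mf : \prod_(i <- enum T2) lin (w i) \is #|T2|.-homog.
    rewrite cardE; elim: (enum T2) => [|i l IH]; first by rewrite big_nil dhomog1.
    by rewrite big_cons /= -add1n; apply: dhomogM IH; apply: lin_homog.
  by apply; apply: mlead_supp.
rewrite -dh hq mleadM // mdegD Pd -(cardsID [set j | al j == 0%N] T).
have -> : T :&: [set j | al j == 0%N] = T2 by apply/setP => j; rewrite !inE.
rewrite leq_add2l mdegE !big_split_ord /=; apply: leq_trans (leq_addr _ _).
apply: leq_trans (leq_addl _ _); rewrite -sum1_card big_mkcond /=.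
apply: leq_sum => j _; rewrite !inE; case: ifP => // /andP[alj _].
by have /part_supp[_ ->] := mlead_supp q0; rewrite lt0n.
Qed.

Lemma pair_count : (s <= d)%N /\ (m <= d * (d - s))%N.
Proof.
split; first exact: leq_trans (leq_addr _ _) (pair_mdeg (mlead_supp g_neq0)).
have wC i j : (w i <= w j)%MS -> (w j <= w i)%MS.
  case/sub_rVP => c wij; have c0 : c != 0.
    by apply: contra (w_neq0 i) => /eqP c0; rewrite wij c0 scale0r.
  by apply/sub_rVP; exists c^-1; rewrite wij scalerA mulVf // scale1r.
(* The first index of the proportionality class of j; the default is never reached, since j itself
   qualifies. *)
pose rep j := odflt j [pick l | (w l <= w j)%MS].
have repP j : (w (rep j) <= w j)%MS.
  by rewrite /rep; case: pickP => [l //|_] /=; apply: submx_refl.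
have rep_eq i j : (w i <= w j)%MS -> rep i = rep j.
  move=> wij; rewrite /rep (@eq_pick _ _ [pred l | (w l <= w j)%MS]) => [|l /=].
    by case: pickP => // /(_ j); rewrite /= submx_refl.
  by apply/idP/idP => wl; apply: submx_trans wl _; last exact: wC.
pose T := rep @: [set: 'I_m].
have : (#|T| <= d)%N.
  apply: pair_classes => _ _ /imsetP[i _ ->] /imsetP[j _ ->] wij; apply: rep_eq.
  exact: submx_trans (wC _ _ (repP i)) (submx_trans wij (repP j)).
move=> Td; have {}Td := leq_mul Td (leqnn (d - s)); rewrite -sum_nat_const in Td.
apply: leq_trans Td; rewrite -[X in (X <= _)%N]card_ord -sum1_card.
rewrite (partition_big rep (mem T)) => [|j _]; last exact: imset_f.
apply: leq_sum => t _; apply: leq_trans (pair_class_size t).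
rewrite -sum1_card big_mkcond [X in (_ <= X)%N]big_mkcond /=.
apply: leq_sum => j _; rewrite inE; case: eqP => // <-.
by rewrite (wC _ _ (repP j)).
Qed.

End PairCount.

Lemma ex_max_nat (P : nat -> Prop) b :
  (exists m, P m) -> (forall m, P m -> (m <= b)%N) ->
  exists2 m, P m & forall m', P m' -> (m' <= m)%N.
Proof.
move=> [m Pm] Pb; have [l] := ubnP (b - m); elim: l m Pm => // l IH m Pm bm.
have [[m' [Pm' mm']]|nex] := classic (exists m', P m' /\ (m < m')%N).
  by apply: (IH m') => //; have := Pb _ Pm'; lia.
exists m => // m' Pm'; rewrite leqNgt; apply/negP => mm'.
by apply: nex; exists m'.
Qed.

Lemma sub_colmxl (K : fieldType) k m1 m2 n (D : 'M[K]_(k, n)) (A : 'M_(m1, n))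
    (B : 'M_(m2, n)) : (D <= A)%MS -> (D <= col_mx A B)%MS.
Proof. by rewrite -addsmxE => DA; apply: submx_trans DA (addsmxSl _ _). Qed.

Lemma sub_colmxr (K : fieldType) k m1 m2 n (D : 'M[K]_(k, n)) (A : 'M_(m1, n))
    (B : 'M_(m2, n)) : (D <= B)%MS -> (D <= col_mx A B)%MS.
Proof. by rewrite -addsmxE => DB; apply: submx_trans DB (addsmxSr _ _). Qed.

Lemma in_id_pair (K : fieldType) n (a b : 'rV[K]_n) f :
  in_id (col_mx a b) f -> exists p q, f = lin a * p + lin b * q.
Proof.
move=> [g ->]; exists (g (lshift 1 0)), (g (rshift 1 0)).
by rewrite big_split_ord !big_ord1 rowKu rowKd !row_id.
Qed.

Lemma row_free_compl (K : fieldType) m n (A : 'M[K]_(m, n)) : row_free A ->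
  exists q (C : 'M_(q, n)), row_free (col_mx A C) && row_full (col_mx A C).
Proof.
move=> Afree; exists (\rank A^C%MS), (row_base A^C%MS).
have full : row_full (col_mx A (row_base A^C%MS)).
  rewrite -sub1mx -addsmxE (adds_eqmx (eqmx_refl A) (eq_row_base _)) sub1mx.
  exact: addsmx_compl_full.
rewrite full andbT -row_leq_rank (eqP full) mxrank_compl (eqP Afree).
by rewrite subnKC // -(eqP Afree) rank_leq_col.
Qed.

(** * Choosing the pairs in slice rank two *)

Section RankTwo.
Variables (K : fieldType) (n d : nat) (f : {mpoly K[n]}).
Hypotheses (f_neq0 : f != 0) (fd : f \is d.-homog).
Hypothesis fmin : forall k (B : 'M_(k, n)), in_id B f -> (2 <= \rank B)%N.
Let F (W : 'M_n) := in_id W f /\ \rank W = 2.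
Hypothesis F_ex : exists W, F W.

Lemma pair_in_id W (a b : 'rV_n) : F W -> a != 0 -> (a <= W)%MS ->
  (b <= W)%MS -> ~~ (b <= a)%MS ->
  (W <= col_mx a b)%MS /\ in_id (col_mx a b) f.
Proof.
move=> [Wf rW] a0 aW bW ba; suff Wab : (W <= col_mx a b)%MS.
  by split=> //; apply: in_idS Wf.
have abW : (col_mx a b <= W)%MS by rewrite col_mx_sub aW bW.
have ltab : (a < col_mx a b)%MS.
  by rewrite ltmxE col_mx_sub (negPf ba) andbF andbT sub_colmxl.
rewrite -(mxrank_leqif_sup abW) rW eqn_leq rank_leq_row /=.
by have := rank_ltmx ltab; rewrite rank_rV a0.
Qed.


(** The spaces W_i are kept as bases, rows i of [X] and [Y]; freeness of the stacked matrix says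
    that their sum is direct. *)
Let direct_pairs s (X Y : 'M_(s, n)) :=
  row_free (col_mx X Y) /\ forall i, in_id (col_mx (row i X) (row i Y)) f.
Let meeting_pairs p (A : 'M_(p, n)) m (w v : 'M_(m, n)) :=
  row_free (col_mx A v) /\ forall j,
    [/\ (row j w <= A)%MS, row j w != 0 & in_id (col_mx (row j w) (row j v)) f].

(** Take s maximal: a member meeting the sum trivially could be appended. Then s > 0, because a
    member cannot meet the zero space nontrivially. *)
Lemma ex_direct_pairs : exists s (X Y : 'M_(s, n)),
  [/\ (0 < s)%N, direct_pairs X Y &
    forall W, F W -> exists2 a : 'rV_n, (a <= W :&: col_mx X Y)%MS & a != 0].
Proof.
have F_basis W : F W -> exists a b : 'rV_n,
    (W <= col_mx a b)%MS /\ in_id (col_mx a b) f.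
  move=> FW; have [_ rW] := FW.
  have /rowV0Pn[a aW a0] : W != 0 by rewrite -mxrank_eq0 rW.
  have /row_subPn[i Wi] : ~~ (W <= a)%MS.
    by apply/negP => /mxrankS; rewrite rW rank_rV a0.
  by exists a, (row i W); apply: pair_in_id => //; apply: row_sub.
pose P s := exists X Y : 'M_(s, n), direct_pairs X Y.
have P0 : P 0%N.
  by exists 0, 0; split=> [|[]//]; rewrite -row_leq_rank.
have Pn s : P s -> (s <= n)%N.
  move=> [X [Y [/eqP rXY _]]]; apply: leq_trans (leq_addr s s) _.
  by rewrite -rXY rank_leq_col.
have [s [X [Y XY]] smax] := ex_max_nat (ex_intro _ _ P0) Pn.
have XYF W : F W -> exists2 a : 'rV_n, (a <= W :&: col_mx X Y)%MS & a != 0.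
  move=> FW; apply/rowV0Pn/negP => /eqP/mxrank_disjoint_sum.
  have [[_ ->] [/eqP-> XYf]] := (FW, XY).
  have [a [b [Wab abf]]] := F_basis W FW => rWXY.
  suff : (s + 1 <= s)%N by rewrite addn1 ltnn.
  apply: smax; exists (col_mx X a), (col_mx Y b); split=> [|i].
    rewrite -row_leq_rank; apply: (@leq_trans (2 + (s + s))); first by lia.
    rewrite -rWXY mxrankS // addsmx_sub.
    rewrite (submx_trans Wab) !col_mx_sub.
      by rewrite (sub_colmxl _ (sub_colmxl _ _)) // (sub_colmxr _ (sub_colmxl _ _)).
    by rewrite (sub_colmxl _ (sub_colmxr _ _)) // (sub_colmxr _ (sub_colmxr _ _)).
  by case: (split_ordP i) => j ->; rewrite !(rowKu, rowKd) // !row_id.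
exists s, X, Y; split=> //; rewrite lt0n; apply/eqP => s0.
have [W FW] := F_ex; have [a /submx_trans/(_ (capmxSr _ _))] := XYF W FW.
move=> /mxrankS; rewrite rank_rV => /leq_trans/(_ (rank_leq_row _)).
by rewrite s0; case: (a != 0).
Qed.

(** Take m maximal: a member outside the span has a row outside it, which together with a common
    vector of the member and [A] would form a further pair. *)
Lemma ex_meeting_pairs p (A : 'M_(p, n)) : row_free A ->
  (forall W, F W -> exists2 a : 'rV_n, (a <= W :&: A)%MS & a != 0) ->
  exists m (w v : 'M_(m, n)), meeting_pairs A w v /\
    forall W, F W -> (W <= col_mx A v)%MS.
Proof.
move=> Afree AF; pose P m := exists w v : 'M_(m, n), meeting_pairs A w v.
have P0 : P 0%N.
  exists 0, 0; split=> [|[]//]; rewrite -row_leq_rank.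
  apply: (@leq_trans (\rank A)); first by rewrite (eqP Afree) addn0.
  by rewrite mxrankS // sub_colmxl.
have Pn m : P m -> (m <= n)%N.
  move=> [w [v [/eqP rAv _]]]; apply: leq_trans (leq_addl p m) _.
  by rewrite -rAv rank_leq_col.
have [m [w [v [Av wv]]] mmax] := ex_max_nat (ex_intro _ _ P0) Pn.
exists m, w, v; split=> // W FW; apply: contraT => /row_subPn[i Wi].
have [a] := AF W FW; rewrite sub_capmx => /andP[aW aA] a0.
suff : (m + 1 <= m)%N by rewrite addn1 ltnn.
apply: mmax; exists (col_mx w a), (col_mx v (row i W)); split=> [|j].
  rewrite -row_leq_rank; apply: (@leq_trans (p + m).+1); first by lia.
  rewrite -(eqP Av); apply: rank_ltmx.
  rewrite ltmxE !col_mx_sub (negPf Wi) !andbF andbT.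
  by apply/andP; split; [apply: sub_colmxl | apply/sub_colmxr/sub_colmxl].
case: (split_ordP j) => l ->; rewrite !(rowKu, rowKd) // !row_id.
split=> //; have [|//] := @pair_in_id W a (row i W) FW a0 aW (row_sub _ _).
apply: contra Wi => /submx_trans; apply.
exact: sub_colmxl.
Qed.

(** Completing the rows of [X], [Y] and [v] to a basis [E] turns them into variables; g is f in
    these coordinates, and [pair_count] applies. *)
Lemma meeting_count s (X Y : 'M_(s, n)) m (w v : 'M_(m, n)) :
  direct_pairs X Y -> meeting_pairs (col_mx X Y) w v ->
  (s <= d)%N /\ (m <= d * (d - s))%N.
Proof.
move=> [_ XYf] [Bfree wvP].
have [q [C /andP[Efree Efull]]] := row_free_compl Bfree.
set E := col_mx _ C in Efree Efull; pose E' := pinvmx E.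
have EE' : E *m E' = 1%:M by apply: mulmxVp.
have E'E : E' *m E = 1%:M by apply: mulVpmx.
pose g := substmx E' f.
have fg : f = substmx E g by rewrite sub_comp E'E sub_id.
have rowE i : row i E *m E' = delta_mx 0 i by rewrite -row_mul EE' row1.
have rowX i : row i X *m E' = delta_mx 0 (lshift q (lshift m (lshift s i))).
  by rewrite -rowE !rowKu.
have rowY i : row i Y *m E' = delta_mx 0 (lshift q (lshift m (rshift s i))).
  by rewrite -rowE !rowKu rowKd.
have rowv j : row j v *m E' = delta_mx 0 (lshift q (rshift (s + s) j)).
  by rewrite -rowE rowKu rowKd.
apply: (@pair_count K s m q g d (fun j => row j w *m E')).
- by apply: contra f_neq0 => /eqP g0; rewrite fg g0 linear0.
- exact: sub_homog.
- move=> i; have := in_id_sub E' (XYf i).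
  by rewrite mul_col_mx rowX rowY -!lin_delta; apply: in_id_pair.
- move=> j; have [_ _ /(in_id_sub E')] := wvP j.
  by rewrite mul_col_mx rowv -lin_delta; apply: in_id_pair.
- move=> j l; have [/submxP[c ->] _ _] := wvP j.
  suff -> : c *m col_mx X Y = row_mx (row_mx c 0) 0 *m E.
    by rewrite -mulmxA EE' mulmx1 row_mxEl row_mxEr mxE.
  by rewrite !mul_row_col !mul0mx !addr0.
- move=> j; have [_ + _] := wvP j; apply: contra => /eqP w0.
  by rewrite -[row j w]mulmx1 -E'E mulmxA w0 mul0mx.
(* A linear form dividing f would contradict slice rank two. *)
move=> j /(in_id_sub E); rewrite -fg -mulmxA E'E mulmx1 => /fmin.
by rewrite rank_rV; case: eqP.
Qed.

Lemma min_family2_bound : exists s (Z : 'M_n), [/\ (0 < s <= d)%N,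
  (\rank Z <= s + s + d * (d - s))%N & forall W, F W -> (W <= Z)%MS].
Proof.
have [s [X [Y [s0 XY XYF]]]] := ex_direct_pairs.
have [m [w [v [wv FZ]]]] := ex_meeting_pairs (proj1 XY) XYF.
have [sd md] := meeting_count XY wv.
exists s, <<col_mx (col_mx X Y) v>>%MS; rewrite s0 sd; split=> // [|W FW].
  by rewrite genmxE (leq_trans (rank_leq_row _)) // leq_add2l.
by rewrite genmxE FZ.
Qed.

End RankTwo.

(** * Cubics *)

Section Core.
Variables (K : fieldType) (n r : nat) (F : 'M[K]_n -> Prop).
Hypothesis F_rank : forall W, F W -> \rank W = r.
Hypothesis F_ex : exists W, F W.

(* [A] is the sum of finitely many members of the family, with the same
   intersection [I] as the whole family.  The first two members [W1], [W2] are
   chosen with [c = r - \rank (W1 :&: W2)] maximal, so that each further member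
   adds at most [c] to the rank of the sum, while it can be chosen to decrease
   the rank of the intersection. *)
Lemma ex_core : exists (I A : 'M_n) c,
  [/\ forall W, F W -> (I <= W)%MS, exists2 W, F W & (W <= A)%MS,
      forall a : 'rV_n, (forall W, F W -> (W <= A)%MS -> (a <= W)%MS) -> (a <= I)%MS,
      (\rank I + c <= r)%N &
      (\rank A <= r + c + c * (r - c - \rank I))%N].
Proof.
pose P c := exists W1 W2, [/\ F W1, F W2 & (\rank (W1 :&: W2) + c)%N = r].
have [c [W1 [W2 [F1 F2 c12]]] cmax] : exists2 c, P c & forall c', P c' -> (c' <= c)%N.
  apply: (@ex_max_nat P r) => [|c [W1 [W2 [_ _ <-]]]]; last exact: leq_addl.
  have [W FW] := F_ex; exists 0%N, W, W.
  by rewrite (capmx_idPl (submx_refl W)) addn0 F_rank.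
(* By maximality of [c], every member meets [W1] in rank at least [r - c], so it adds at most [c] to
   the rank of any space containing [W1]. *)
have capW W : F W -> (r <= \rank (W1 :&: W) + c)%N.
  move=> FW; have le1 := mxrankS (capmxSl W1 W); rewrite (F_rank F1) in le1.
  suff /cmax : P (r - \rank (W1 :&: W))%N by lia.
  by exists W1, W; rewrite subnKC.
pose good (I A : 'M_n) := forall a : 'rV_n,
  (forall W, F W -> (W <= A)%MS -> (a <= W)%MS) -> (a <= I)%MS.
(* A further member raises [\rank A] by at most [c] and lowers [\rank I] by at least one, so
   [\rank A + c * \rank I] never grows; for [W1] and [W2] it equals [r + c + c * (r - c)]. *)
suff [I [A [IF W1A gIA rA]]] : exists I A : 'M_n,
    [/\ forall W, F W -> (I <= W)%MS, (W1 <= A)%MS, good I A &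
        (\rank I + c <= r)%N /\ (\rank A + c * \rank I <= r + c + c * (r - c))%N].
  exists I, A, c; case: rA => rI rA; split=> //; first by exists W1.
  have le (i a : nat) : (i + c <= r -> a + c * i <= r + c + c * (r - c) ->
      a <= r + c + c * (r - c - i))%N.
    move=> ic; have ir : (i <= r - c)%N by lia.
    by have := leq_mul (leqnn c) ir; rewrite (mulnBr c (r - c)%N); lia.
  exact: le.
have [rI rA] : (\rank (W1 :&: W2) + c)%N = r /\ \rank (W1 + W2)%MS = (r + c)%N.
  split=> //; apply/eqP; rewrite -(eqn_add2r (\rank (W1 :&: W2))).
  by rewrite mxrank_sum_cap (F_rank F1) (F_rank F2) -addnA [(c + _)%N]addnC c12.
have : good (W1 :&: W2)%MS (W1 + W2)%MS.
  by move=> a aF; rewrite sub_capmx !aF ?addsmxSl ?addsmxSr.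
have : (\rank (W1 + W2)%MS + c * \rank (W1 :&: W2) <= r + c + c * (r - c))%N.
  by rewrite rA -[in (r - c)%N]rI addnK.
have : (\rank (W1 :&: W2) + c <= r)%N by rewrite rI.
have : (W1 <= W1 + W2)%MS by rewrite addsmxSl.
move: (W1 :&: W2)%MS (W1 + W2)%MS {rI rA c12} => I A.
have [l] := ubnP (\rank I); elim: l I A => // l IH I A Il W1A rI rA gIA.
have [IF|nIF] := classic (forall W, F W -> (I <= W)%MS); first by exists I, A.
have [W nW] := not_all_ex_not _ _ nIF; have [FW nIW] := imply_to_and _ _ nW.
have ltI : (\rank (W :&: I) < \rank I)%N.
  by apply: rank_ltmx; rewrite ltmxE capmxSr sub_capmx submx_refl andbT; apply/negP.
have rWA : (\rank (W + A)%MS <= \rank A + c)%N.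
  rewrite -(leq_add2r (\rank (W :&: A))) mxrank_sum_cap (F_rank FW) -addnA addnC.
  rewrite leq_add2l addnC (leq_trans (capW W FW)) // leq_add2r capmxC.
  by rewrite mxrankS ?capmxS.
have step (i i' a a' : nat) : (i' < i -> a' <= a + c -> i + c <= r ->
    a + c * i <= r + c + c * (r - c) -> i' + c <= r /\
    a' + c * i' <= r + c + c * (r - c))%N.
  by move=> i'i a'a ir ai; split; nia.
have [rI' rA'] := step _ _ _ _ ltI rWA rI rA.
apply: (IH (W :&: I)%MS (W + A)%MS) => // [||a aF].
- exact: leq_trans ltI Il.
- exact: submx_trans W1A (addsmxSr _ _).
rewrite sub_capmx aF ?addsmxSl //=; apply: gIA => W' FW' W'A; apply: aF => //.
exact: submx_trans W'A (addsmxSr _ _).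
Qed.

End Core.

Lemma mxrank_sum_leq (K : fieldType) n (T : Type) (s : seq T) (P : pred T)
    (B : T -> 'M[K]_n) :
  (\rank (\sum_(i <- s | P i) B i)%MS <= \sum_(i <- s | P i) \rank (B i))%N.
Proof.
elim/big_rec2: _ => [|i k A _ IH]; first by rewrite mxrank0.
by apply: leq_trans (mxrank_adds_leqif _ _) _; rewrite leq_add2l.
Qed.

Lemma sum_pairs j : (2 * (\sum_(a < j) \sum_(b < j | a <= b) 1) = j * j.+1)%N.
Proof.
rewrite (exchange_big_dep predT) //=.
rewrite (eq_bigr (fun b : 'I_j => b.+1)) => [|b _].
  elim: j => [|j IH]; first by rewrite big_ord0.
  by rewrite big_ord_recr /= mulnDr IH; lia.
by rewrite -(big_ord_widen j (fun=> 1%N) (ltn_ord b)) sum_nat_const card_ord muln1.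
Qed.


Lemma mnm_splitU k (mu : 'X_{1..k}) u :
  (0 < mu u)%N -> mu = (U_(u) + (mu - U_(u)))%MM.
Proof. by move=> muu; rewrite addmC submK // lep1mP -lt0n. Qed.

(** * Cubics in adapted coordinates *)

Section CubicCoordinates.
Variables (K : fieldType) (i j q m : nat).
Let k := (i + j + q)%N.
(** The first i variables are a basis of I, the next j complete it to a basis of A. *)
Let vA (t : 'I_(i + j)) : 'I_k := lshift q t.
Let vI (t : 'I_i) : 'I_k := vA (lshift j t).
Let vJ (t : 'I_j) : 'I_k := vA (rshift i t).
Variables (g : {mpoly K[k]}) (Ic : 'M[K]_(m, k)).
Hypothesis gd : g \is 3.-homog.
Hypothesis gA : exists h, g = \sum_t 'X_(vA t) * h t.
Hypothesis gJ : forall nu : 'X_{1..k}, (forall t, nu (vA t) = 0%N) ->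
  forall t, g@_(U_(vJ t) + nu) = 0.
Hypothesis IcP : forall t, in_id Ic 'X_(vI t).

(** A monomial of g without I variables has a J variable by [gA]. By [gJ] its quotient still
    involves A, so it has a second one; degree 3 leaves a single variable. *)
Lemma cubic_mnm mu : mu \in msupp g ->
  (exists t, 0 < mu (vI t))%N \/
  exists (a b : 'I_j) c, (a <= b)%N /\ mu = (U_(vJ a) + U_(vJ b) + U_(c))%MM.
Proof.
move=> mug; have mu3 : mdeg mu = 3 := dhomog_mf gd mug.
have [/existsP[t mut]|/existsPn muI] := boolP [exists t, 0 < mu (vI t)]%N.
  by left; exists t.
have {}muI t : mu (vI t) = 0%N by have := muI t; rewrite lt0n negbK => /eqP.
have vA0 (nu : 'X_{1..k}) : (forall t, nu (vI t) = 0%N) ->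
    ~~ [exists t, 0 < nu (vJ t)]%N -> forall t, nu (vA t) = 0%N.
  move=> nuI /existsPn nuJ t; case: (split_ordP t) => l ->; first exact: nuI.
  by have := nuJ l; rewrite lt0n negbK => /eqP.
right; have [/existsP[a /mnm_splitU]|/(vA0 _ muI) muA] :=
    boolP [exists t, 0 < mu (vJ t)]%N; last first.
  have [h gh] := gA; move: mug; rewrite mcoeff_msupp gh raddf_sum big1 ?eqxx //= => t _.
  by rewrite mcoeffXM muA.
set nu := (_ - _)%MM => mu_a; have nuI t : nu (vI t) = 0%N by rewrite mnmBE muI.
have [/existsP[b /mnm_splitU]|/(vA0 _ nuI) nuA] :=
    boolP [exists t, 0 < nu (vJ t)]%N; last first.
  by move: mug; rewrite mu_a mcoeff_msupp gJ ?eqxx.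
set xi := (_ - _)%MM => nu_b.
have /mdeg1P[c /eqP xi_c] : mdeg xi == 1%N.
  by move/eqP: mu3; rewrite mu_a nu_b !mdegD !mdeg1.
have [ab|/ltnW ba] := leqP a b; [exists a, b, c | exists b, a, c]; split=> //.
  by rewrite mu_a nu_b xi_c addmA.
by rewrite mu_a nu_b xi_c addmA [(U_(vJ a) + _)%MM]addmC.
Qed.

(** The property is stable under sums, so it is checked on the monomials of g, sorted by
    [cubic_mnm]. *)
Lemma cubic_decomp : exists N : 'I_j -> 'I_j -> 'rV[K]_k,
  in_id Ic (g - \sum_(a < j) \sum_(b < j | (a <= b)%N)
                  'X_(vJ a) * 'X_(vJ b) * lin (N a b)).
Proof.
pose S (N : 'I_j -> 'I_j -> 'rV[K]_k) : {mpoly K[k]} :=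
  \sum_(a < j) \sum_(b < j | (a <= b)%N) 'X_(vJ a) * 'X_(vJ b) * lin (N a b).
pose P p := exists N, in_id Ic (p - S N); change (P g).
have S0 : S (fun _ _ => 0) = 0.
  by rewrite /S big1 // => a _; rewrite big1 // => b _; rewrite linear0 mulr0.
have SD N N' : S (fun a b => N a b + N' a b) = S N + S N'.
  rewrite /S -big_split; apply: eq_bigr => a _; rewrite -big_split.
  by apply: eq_bigr => b _; rewrite linearD mulrDr.
have SZ c N : S (fun a b => c *: N a b) = c *: S N.
  rewrite /S scaler_sumr; apply: eq_bigr => a _; rewrite scaler_sumr.
  by apply: eq_bigr => b _; rewrite linearZ /= -scalerAr.
have P0 p : in_id Ic p -> P p by exists (fun _ _ => 0); rewrite S0 subr0.
rewrite (mpolyE g) big_seq; elim/big_ind: _ => [|p p' [N pN] [N' pN']|mu mug].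
- exact/P0/in_id0.
- exists (fun a b => N a b + N' a b).
  by rewrite SD opprD addrACA; apply: in_idD.
have [[t /mnm_splitU mut]|[a [b [c [ab muE]]]]] := cubic_mnm mug.
  have -> : 'X_[mu] = 'X_(vI t) * 'X_[(mu - U_(vI t))%MM] :> {mpoly K[k]}.
    by rewrite -mpolyXD -mut.
  exact/P0/in_idZ/in_idMr.
pose N a' b' : 'rV[K]_k := ((a' == a) && (b' == b))%:R *: delta_mx 0 c.
exists (fun a' b' => g@_mu *: N a' b').
rewrite SZ -scalerBr; suff -> : S N = 'X_[mu].
  by rewrite subrr scaler0; apply: in_id0.
rewrite /S /N (bigD1 a) //= (bigD1 b) //= !eqxx scale1r lin_delta -!mpolyXD -muE.
rewrite big1 => [|b' /andP[_ /negPf->]]; last by rewrite andbF scale0r linear0 mulr0.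
rewrite addr0 big1 ?addr0 // => a' /negPf a'a; rewrite big1 // => b' _.
by rewrite a'a scale0r linear0 mulr0.
Qed.

End CubicCoordinates.

(** As [l] is outside [Z], some column [u] has [l *m u = 1] and [Z *m u = 0]. The projection
    [1 - u *m l] moves vectors only by multiples of [l], so it preserves any [W] containing [l]. *)
Lemma ex_kill (K : fieldType) n (Z : 'M[K]_n) (l : 'rV_n) : ~~ (l <= Z)%MS ->
  exists P : 'M_n, [/\ l *m P = 0, Z *m P = Z &
    forall W : 'M_n, (l <= W)%MS -> (W *m P <= W)%MS].
Proof.
rewrite submxE; move: (cokermx Z) (mulmx_coker Z) => C ZC.
case/rV0Pn => j lj; pose u := ((l *m C) 0 j)^-1 *: col j C.
have lu : l *m u = 1%:M.
  rewrite -scalemxAr colE mulmxA -colE; apply/matrixP => a b; rewrite !ord1.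
  by rewrite mxE [col _ _ _ _]mxE [RHS]mxE mulVf.
have Zu : Z *m u = 0 by rewrite -scalemxAr colE mulmxA ZC mul0mx scaler0.
exists (1%:M - u *m l); split=> [||W lW]; rewrite mulmxBr mulmx1 mulmxA.
- by rewrite lu mul1mx subrr.
- by rewrite Zu mul0mx subr0.
by rewrite addmx_sub // eqmx_opp; apply: mulmx_sub.
Qed.

Lemma mcoeff_lin_row (K : fieldType) p q (a : 'rV[K]_p) h (nu : 'X_{1..p + q}) t :
  (forall t, nu (lshift q t) = 0%N) ->
  (lin (row_mx a 0) * h)@_(U_(lshift q t) + nu) = a 0 t * h@_nu.
Proof.
move=> nu0; rewrite /lin mulr_suml raddf_sum big_split_ord /= [X in _ + X]big1.
  rewrite addr0 (bigD1 t) //= row_mxEl -scalerAl mcoeffZ mcoeffXM mnmDE mnm1E eqxx.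
  rewrite addmC addmK big1 ?addr0 // => u /negPf ut.
  rewrite -scalerAl mcoeffZ mcoeffXM mnmDE mnm1E nu0 eq_sym.
  by rewrite (inj_eq (@lshift_inj _ _)) ut mulr0.
by move=> u _; rewrite row_mxEr mxE scale0r mul0r mcoeff0.
Qed.

(** * Bounding the span of the family of a cubic *)

Section CubicBound.
Variables (K : fieldType) (n r : nat) (f : {mpoly K[n]}).
Hypothesis fd : f \is 3.-homog.
Hypothesis fmin : forall k (B : 'M_(k, n)), in_id B f -> (r <= \rank B)%N.
Let F (W : 'M_n) := in_id W f /\ \rank W = r.

(* If [l] in [W] were not in [Z], a projection killing [l] and fixing [Z] would
   send [W] to a smaller subspace whose ideal still contains [f]. *)
Lemma family_sub (I Z : 'M_n) h : (I <= Z)%MS -> in_id I (f - h) ->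
  (forall P : 'M_n, Z *m P = Z -> substmx P h = h) ->
  forall W, F W -> (I <= W)%MS -> (W <= Z)%MS.
Proof.
move=> IZ fh Zh W [Wf rW] IW; apply: contraT => /row_subPn[i lZ].
set l := row i W in lZ; have lW : (l <= W)%MS by apply: row_sub.
have [P [lP ZP WP]] := ex_kill lZ.
have IP : I *m P = I by case/submxP: IZ => D ->; rewrite -mulmxA ZP.
have IWP : (I <= W *m P)%MS by rewrite -IP submxMr.
have : in_id (W *m P) f.
  (* As [P] fixes [h], the difference of f and its image is that of [f - h] and its image, both in
     the ideal of [I]. *)
  have -> : f = substmx P f + ((f - h) - substmx P (f - h)).
    by rewrite linearB /= Zh // opprB [f - h + _]addrA subrK addrCA subrr addr0.
  apply: in_idD; first exact: in_id_sub.
  apply: in_idB; first exact: in_idS IWP fh.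
  by apply: in_idS IWP _; rewrite -IP; apply: in_id_sub.
move=> /fmin; rewrite leqNgt => /negP[]; rewrite -rW -(mxrank_mul_ker W P).
(* The rank drops strictly because [l] is a nonzero vector of [W] killed by [P]. *)
rewrite -[X in (X < _)%N]addn0 ltn_add2l lt0n mxrank_eq0.
apply: contraNneq lZ => W0; suff : (l <= W :&: kermx P)%MS.
  by rewrite W0 submx0 => /eqP->; apply: sub0mx.
by rewrite sub_capmx lW; apply/sub_kermxP.
Qed.

Lemma cubic_mod (I A : 'M_n) : (forall W, F W -> (I <= W)%MS) ->
  (exists2 W, F W & (W <= A)%MS) ->
  (forall a : 'rV_n, (forall W, F W -> (W <= A)%MS -> (a <= W)%MS) -> (a <= I)%MS) ->
  exists j (J : 'I_j -> 'rV_n) (N : 'I_j -> 'I_j -> 'rV_n),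
    [/\ (\rank I + j)%N = \rank A, forall a, (J a <= A)%MS &
      in_id I (f - \sum_(a < j) \sum_(b < j | (a <= b)%N)
                     lin (J a) * lin (J b) * lin (N a b))].
Proof.
move=> IF [W0 FW0 W0A] Imax.
have IA : (I <= A)%MS := submx_trans (IF _ FW0) W0A.
pose i := \rank I; pose j := \rank (A :\: I)%MS.
pose Ib : 'M_(i, n) := row_base I; pose Jb : 'M_(j, n) := row_base (A :\: I)%MS.
pose B := col_mx Ib Jb.
have ij : (i + j)%N = \rank A.
  rewrite -(mxrank_cap_compl A I) /i /j; congr (_ + _)%N.
  by apply: eqmx_rank; rewrite sub_capmx IA submx_refl capmxSr.
have BA : (B :=: A)%MS.
  apply: eqmx_trans (addsmx_diff_cap_eq A I).
  apply: eqmx_trans (eqmx_sym (addsmxE _ _)) _.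
  rewrite addsmxC; apply: adds_eqmx; first exact: eq_row_base.
  apply: eqmx_trans (eq_row_base _) _; apply/eqmxP.
  by rewrite sub_capmx IA submx_refl capmxSr.
have Bfree : row_free B by rewrite -row_leq_rank BA ij.
have [q [C /andP[Efree Efull]]] := row_free_compl Bfree.
set E := col_mx B C in Efree Efull; pose E' := pinvmx E.
have EE' : E *m E' = 1%:M by apply: mulmxVp.
have E'E : E' *m E = 1%:M by apply: mulVpmx.
have BE' : B *m E' = row_mx 1%:M 0.
  have -> : B = row_mx 1%:M 0 *m E by rewrite mul_row_col mul1mx mul0mx addr0.
  by rewrite -mulmxA EE' mulmx1.
have rowE t : row t E *m E' = delta_mx 0 t by rewrite -row_mul EE' row1.
have subE t : lin (row t E) = substmx E 'X_t by rewrite subX.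
pose g := substmx E' f; have fg : f = substmx E g by rewrite sub_comp E'E sub_id.
have [|||t|N gN] := @cubic_decomp K i j q i g (Ib *m E').
- exact: sub_homog.
- have [h ->] : in_id (B *m E') g 
    by apply/in_id_sub/(in_idS _ (proj1 FW0)); rewrite BA.
  exists h; apply: eq_bigr => t _; congr (_ * _).
  by rewrite row_mul -(rowKu _ B C) rowE lin_delta.
(* The part of g linear in A: for a member [W] below [A], membership of g in its ideal writes [c] as
   a combination of the rows of [D]. So [c *m B] lies in every such [W], hence in [I], and its J
   coordinates vanish. *)
- move=> nu nuA t0; pose c : 'rV_(i + j) := \row_t g@_(U_(lshift q t) + nu).
  have /Imax : forall W, F W -> (W <= A)%MS -> (c *m B <= W)%MS.
    move=> W FW; rewrite -BA => /submxP[D WD].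
    have [h gW] : in_id (W *m E') g := in_id_sub E' (proj1 FW).
    rewrite WD -mulmxA BE' mul_mx_row mulmx1 mulmx0 in gW.
    have -> : c = (\row_l (h l)@_nu) *m D.
      apply/rowP => t; rewrite !mxE gW raddf_sum; apply: eq_bigr => l _ /=.
      by rewrite row_row_mx row0 mcoeff_lin_row // !mxE mulrC.
    by rewrite -mulmxA -WD submxMl.
  rewrite -(eq_row_base I) => /submxP[z cz].
  have {}cz : row_mx c 0 = row_mx (row_mx z 0) 0 :> 'rV_(i + j + q).
    rewrite -[c]mulmx1 -[0 in LHS](mulmx0 _ c) -mul_mx_row -BE' mulmxA cz.
    have -> : z *m row_base I = row_mx (row_mx z 0) 0 *m E.
      by rewrite !mul_row_col !mul0mx !addr0.
    by rewrite -mulmxA EE' mulmx1.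
  have /rowP/(_ (rshift i t0)) := proj1 (eq_row_mx cz).
  by rewrite row_mxEr !mxE.
- rewrite -lin_delta; apply/in_id_lin.
  by rewrite -rowE !rowKu -row_mul row_sub.
exists j, (fun a => row a Jb), (fun a b => N a b *m E); split=> // [a|].
  by rewrite -BA -(rowKd _ Ib) row_sub.
move: gN; set T := (X in g - X) => gN.
have := in_id_sub E gN; rewrite -mulmxA E'E mulmx1 linearB /= -fg.
move=> /(in_idS (C := I)); rewrite eq_row_base => /(_ (submx_refl _)) fI.
set S := (X in in_id I (f - X)); suff <- : substmx E T = S by exact: fI.
rewrite /T linear_sum; apply: eq_bigr => a _ /=.
rewrite linear_sum; apply: eq_bigr => b _ /=.
by rewrite !rmorphM /= sub_lin !subX !rowKu !rowKd.
Qed.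

Lemma cubic_family_bound : (exists W, F W) -> exists i j c (Z : 'M_n),
  [/\ (i + c <= r)%N, (i + j <= r + c + c * (r - c - i))%N,
      (2 * \rank Z <= 2 * (i + j) + j * j.+1)%N & forall W, F W -> (W <= Z)%MS].
Proof.
move=> F_ex; have [I [A [c [IF WA Imax ic Ac]]]] := ex_core (fun W => @proj2 _ _) F_ex.
have [j [J [N [ij JA fN]]]] := cubic_mod IF WA Imax.
have IA : (I <= A)%MS by have [W /IF IW /(submx_trans IW)] := WA.
(* All forms in the sum lie in [Z], so a projection fixing [Z] fixes the sum, as [family_sub]
   requires. *)
pose Z := (A + \sum_(a < j) \sum_(b < j | (a <= b)%N) <<N a b>>)%MS.
exists (\rank I), j, c, Z; rewrite ij; split=> // [|W FW].
  apply: leq_trans (leq_mul (leqnn 2) (mxrank_adds_leqif _ _)) _.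
  rewrite mulnDr leq_add2l -sum_pairs leq_mul2l /=.
  apply: leq_trans (mxrank_sum_leq _ _ _) _; apply: leq_sum => a _.
  apply: leq_trans (mxrank_sum_leq _ _ _) _; apply: leq_sum => b _.
  by rewrite genmxE rank_leq_row.
apply: (family_sub _ fN) (FW) (IF _ FW).
  exact: submx_trans IA (addsmxSl _ _).
move=> P ZP; have linP (l : 'rV_n) : (l <= Z)%MS -> substmx P (lin l) = lin l.
  by case/submxP=> D ->; rewrite sub_lin -mulmxA ZP.
rewrite linear_sum; apply: eq_bigr => a _ /=.
rewrite linear_sum; apply: eq_bigr => b ab /=.
rewrite !rmorphM /= !linP //; try exact: submx_trans (JA _) (addsmxSl _ _).
apply: submx_trans (addsmxSr _ _).
rewrite (sumsmx_sup a) // (sumsmx_sup b) // genmxE //.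
Qed.

End CubicBound.

(** * Quadrics *)

Section Quadric.
Variables (K : fieldType) (N : nat).
Local Notation n := N.+1.

Lemma restr_mdegXM (i : 'I_n) (p : {mpoly K[n]}) d :
  restr (fun mu => mdeg mu == d.+1) ('X_i * p) =
  'X_i * restr (fun mu => mdeg mu == d) p.
Proof.
apply/mpolyP => mu; rewrite mcoeff_restr !mcoeffXM mcoeff_restr.
case: (ltnP 0 (mu i)) => [/mnm_splitU mui|]; last by rewrite if_same.
by rewrite {1}mui mdegD mdeg1 add1n eqSS.
Qed.

Lemma restr_mdeg_linM (a : 'rV[K]_n) (p : {mpoly K[n]}) d :
  restr (fun mu => mdeg mu == d.+1) (lin a * p) =
  lin a * restr (fun mu => mdeg mu == d) p.
Proof.
rewrite /lin !mulr_suml linear_sum; apply: eq_bigr => i _ /=.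
by rewrite -!scalerAl linearZ /= restr_mdegXM.
Qed.

Lemma restr_mdeg_homog (p : {mpoly K[n]}) d :
  restr (fun mu => mdeg mu == d) p \is d.-homog.
Proof. by apply/dhomogP => mu; rewrite msupp_restr => /andP[/eqP]. Qed.

(** The cofactors need not be homogeneous; comparing terms of degree 2 replaces them by their linear
    parts. *)
Lemma quadric_pullback m (B : 'M_(m, n)) (f : {mpoly K[n]}) :
  f \is 2.-homog -> in_id B f -> exists2 l, (l <= m + m)%N & is_pullback f l.
Proof.
move=> fd [g fg].
pose a i : dhomog n K 1 := DHomog (lin_homog (row i B)).
pose b i : dhomog n K 1 := DHomog (restr_mdeg_homog (g i) 1).
have {}fg : f = \sum_i mpoly_of_dhomog (a i) * mpoly_of_dhomog (b i).
  transitivity (restr (fun mu => mdeg mu == 2) f).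
    apply/mpolyP => mu; rewrite mcoeff_restr; case: eqP => // /eqP.
    exact: dhomog_nemf_coeff.
  by rewrite fg linear_sum; apply: eq_bigr => i _; rewrite /= restr_mdeg_linM.
pose w := [tuple (match split i with inl j => a j | inr j => b j end) | i < m + m].
exists (\dim <<w>>%VS); first by rewrite (leq_trans (dim_span _)) ?size_tuple.
exists <<w>>%VS => //.
exists (m + m)%N, w, (\sum_i 'X_(lshift m i) * 'X_(rshift m i)); split.
  by move=> i; rewrite memv_span // mem_tnth.
rewrite fg linear_sum; apply: eq_bigr => i _ /=.
rewrite rmorphM /= !comp_mpolyXU -!tnth_nth !tnth_map !tnth_ord_tuple.
by rewrite (unsplitK (inl i)) (unsplitK (inr i)).
Qed.

End Quadric.

(** * Numerical bounds and conclusion *)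

Lemma cubic_bound_arith (r i j c z : nat) : (i + c <= r)%N ->
  (i + j <= r + c + c * (r - c - i))%N -> (2 * z <= 2 * (i + j) + j * j.+1)%N ->
  (z%:R : rat) <= 2%:R^-1 * ((r%:R + 1) ^+ 2 / 4%:R + r%:R + 3%:R)
                  * ((r%:R + 1) ^+ 2 / 4%:R + r%:R).
Proof.
move=> icr ijr zij; pose t := ((r + 1) ^ 2 + 4 * r)%N.
(* With e = r - i - c the hypothesis reads i + j <= r + c (e + 1), and 4 c (e + 1) <= (c + e + 1)^2
   <= (r + 1)^2. *)
have ijt : (4 * (i + j) <= t)%N.
  pose e := (r - i - c)%N; have rE : r = (i + c + e)%N by rewrite /e; lia.
  move: ijr; rewrite /t rE; have -> : (i + c + e - c - i = e)%N by lia.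
  by have [+ _] := nat_AGM2 c e.+1; rewrite -!mulnn; nia.
(* Put u = i + j. Then 2 z <= u (u + 3) and 4 u <= t; the target is t (t + 12) / 32. *)
have zt : (z * 32 <= t * (t + 12))%N.
  have := leq_mul ijt (leq_add ijt (leqnn 12)); nia.
have -> : 2%:R^-1 * ((r%:R + 1) ^+ 2 / 4%:R + r%:R + 3%:R)
    * ((r%:R + 1) ^+ 2 / 4%:R + r%:R) = (t * (t + 12))%N%:R / 32%:R :> rat.
  have tE : t%:R = (r%:R + 1) ^+ 2 + 4%:R * r%:R :> rat.
    by rewrite natrD natrX (natrD _ r 1) (natrM _ 4 r).
  by rewrite natrM natrD tE; field.
by rewrite ler_pdivlMr ?ltr0n // -natrM ler_nat.
Qed.

Theorem theoremC (K : fieldType) :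
  (forall (N : nat) (f : {mpoly K[N.+1]}) (r : nat),
     f != 0 -> f \is 3.-homog -> is_min_codim f r ->
     ((codim (Lf f r))%:R : rat) <=
       2%:R^-1 * ((r%:R + 1) ^+ 2 / 4%:R + r%:R + 3%:R)
               * ((r%:R + 1) ^+ 2 / 4%:R + r%:R))
  /\
  (forall (N : nat) (f : {mpoly K[N.+1]}) (d : nat),
     f != 0 -> (2 <= d)%N -> f \is d.-homog -> is_min_codim f 2 ->
     (codim (Lf f 2) <= d ^ 2 + 1)%N /\
     ((codim (Lf f 2) <= d ^ 2 - 1)%N \/
      exists2 m : nat, (m <= d ^ 2 + 1)%N & is_pullback f m)).
Proof.
split=> N f.
  move=> r _ fd /min_codimP[F_ex fmin].
  have [i [j [c [Z [icr ijr Zij FZ]]]]] := cubic_family_bound fd fmin F_ex.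
  apply: le_trans (cubic_bound_arith icr ijr Zij); rewrite ler_nat.
  exact: codim_Lf.
move=> d f0 d2 fd /min_codimP[F_ex fmin].
have [s [Z [/andP[s0 sd] rZ /codim_Lf FZ]]] := min_family2_bound f0 fd fmin F_ex.
have le : (codim (Lf f 2) <= s + s + d * (d - s))%N := leq_trans FZ rZ.
have [d3|d_lt3] := leqP 3 d.
  suff bd : (codim (Lf f 2) <= d ^ 2 - 1)%N by split; [lia | left].
  (* Here d^2 exceeds the bound by s (d - 2), which is positive. *)
  apply: leq_trans le _; have [e dE] : exists e, d = (s + e)%N.
    by exists (d - s)%N; rewrite subnKC.
  rewrite dE -mulnn addKn; rewrite dE in d3; nia.
have {d2 d_lt3} d2 : d = 2 by lia.
(* For d = 2 the bound is 4 for every s: enough for d^2 + 1 but not for d^2 - 1, hence the pullback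
   alternative. *)
split; first by rewrite d2 -mulnn in le sd *; nia.
right; have [W [Wf rW]] := F_ex; rewrite d2 in fd *.
have [|m m4 fm] := @quadric_pullback K N _ (row_base W) f fd.
  by apply: in_idS Wf; rewrite eq_row_base.
by exists m => //; rewrite rW in m4; apply: leq_trans m4 _.
Qed.
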